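(* Let $G$ be a graph. Then ${\sf sd}(G)\le 1$ if and only if $G$ is chordal (i.e., $G$ has no induced cycle of length at least four).
   Context: Graphs are finite, simple and undirected, with nonempty vertex set $V=V(G)=\{1,\dots,n\}$ and edge set $E=E(G)$. ${\cal S}^n_+$ is the set of real symmetric positive semidefinite $n\times n$ matrices. For $c\in[-1,1]^{E}$, the problem ${\rm P}(G,c)$ has feasible set $\{X\in{\cal S}^n_+ : X[i,i]=1\ (i\in V),\ X[i,j]=c(ij)\ (ij\in E)\}$; ${\cal E}(G)$ is the set of $c\in[-1,1]^E$ for which this set is nonempty. A stress is a vector $\omega\in\mathbb{R}^{V\cup E}$; its matrix is $\Omega=\sum_{i\in V}\omega(i)E_{ii}+\sum_{ij\in E}\omega(ij)E_{ij}$, where $E_{ij}=({\bf e}_i{\bf e}_j^{\top}+{\bf e}_j{\bf e}_i^{\top})/2$ (a superscript on $\omega$ is inherited by $\Omega$). For a sequence $\omega^1,\dots,\omega^k$ put ${\cal V}^0=\mathbb{R}^n$ and ${\cal V}^j=\{x\in\mathbb{R}^n : x^{\top}\Omega^i x=0\ (i=1,\dots,j)\}$. Singularity degree: for $c\in{\cal E}(G)$, ${\sf sd}(G,c)=0$ if ${\rm P}(G,c)$ has a positive definite feasible solution; otherwise ${\sf sd}(G,c)$ is the smallest $k$ for which there are stresses $\omega^1,\dots,\omega^k$ such that: (1) for each $j$, $x^{\top}\Omega^j x\ge 0$ for all $x\in{\cal V}^{j-1}$; (2) for each $j$, $\sum_{i\in V}\omega^j(i)+\sum_{ij\in E}\omega^j(ij)c(ij)\le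 0$; (3) $\dim{\cal V}^k=s$, where $s$ is the maximum rank of a feasible solution of ${\rm P}(G,c)$. Finally ${\sf sd}(G)=\max\{{\sf sd}(G,c) : c\in{\cal E}(G)\}$. *)

(* Defs.v *)
From HB Require Import structures.
From mathcomp Require Import all_boot all_order all_algebra.
From mathcomp Require Import reals.

Set Implicit Arguments.
Unset Strict Implicit.
Unset Printing Implicit Defensive.

Import Order.TTheory GRing.Theory Num.Theory.
Local Open Scope ring_scope.

(* A graph on 'I_n is an adjacency relation e : rel 'I_n, symmetric and
   irreflexive.  The edge {i, j} is represented by the ordered pair with its
   smaller endpoint first, so that functions on [edge e] are exactly R^E. *)
Notation edge e :=
  {u : 'I__ * 'I__ | (val u.1 < val u.2)%N && e u.1 u.2}.

Definition induced_cycle n (e : rel 'I_n) k (f : 'I_k -> 'I_n) : Prop :=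
  injective f /\
  forall i j : 'I_k, e (f i) (f j) = (j == ordS i) || (i == ordS j).

Definition chordal n (e : rel 'I_n) : Prop :=
  ~ exists k, exists2 f : 'I_k -> 'I_n, (4 <= k)%N & induced_cycle e f.

Section Completion.
Variables (R : realType) (n : nat).

Definition qform (A : 'M[R]_n) (x : 'cV[R]_n) : R := (x^T *m A *m x) 0 0.

Definition psd (A : 'M[R]_n) : Prop := A^T = A /\ forall x, 0 <= qform A x.

Definition posdef (A : 'M[R]_n) : Prop :=
  A^T = A /\ forall x, x != 0 -> 0 < qform A x.

Definition is_dim (P : 'cV[R]_n -> Prop) (s : nat) : Prop :=
  exists2 U : {vspace 'cV[R]_n}, forall x, x \in U <-> P x & \dim U = s.

Variable e : rel 'I_n.

Definition feasible (c : edge e -> R) (X : 'M[R]_n) : Prop :=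
  [/\ psd X, forall i, X i i = 1
    & forall u : edge e, X (val u).1 (val u).2 = c u].

Definition completable (c : edge e -> R) : Prop :=
  (forall u, -1 <= c u <= 1) /\ exists X, feasible c X.

Definition max_rank (c : edge e -> R) (s : nat) : Prop :=
  (exists2 X, feasible c X & \rank X = s) /\
  forall X, feasible c X -> (\rank X <= s)%N.

Definition stress : Type := ('I_n + edge e)%type -> R.

Definition Emx (i j : 'I_n) : 'M[R]_n :=
  2^-1 *: (delta_mx i j + delta_mx j i).

Definition stress_mx (w : stress) : 'M[R]_n :=
  \sum_(i < n) w (inl i) *: Emx i i +
  \sum_(u : edge e) w (inr u) *: Emx (val u).1 (val u).2.

Definition Vset k (w : 'I_k -> stress) (j : nat) (x : 'cV[R]_n) : Prop :=
  forall i : 'I_k, (i < j)%N -> qform (stress_mx (w i)) x = 0.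

(* Stresses are numbered from 0 here, so the (j+1)-st stress w j is required
   to be nonnegative on [Vset w j], which is cut out by the first j ones.
   [is_dim] includes that the last [Vset] is a linear subspace; this is a
   consequence of the first condition. *)
Definition certificate (c : edge e -> R) k (w : 'I_k -> stress) : Prop :=
  [/\ forall (j : 'I_k) x, Vset w j x -> 0 <= qform (stress_mx (w j)) x,
      forall j : 'I_k,
        \sum_(i < n) w j (inl i) + \sum_(u : edge e) w j (inr u) * c u <= 0
    & exists2 s, max_rank c s & is_dim (Vset w k) s].

(* [sd_completion c k] : k is the singularity degree of P(G, c). *)
Definition sd_completion (c : edge e -> R) (k : nat) : Prop :=
  let has_posdef := exists2 X, feasible c X & posdef X in
  let reachable m := exists w : 'I_m -> stress, certificate c w in
  (has_posdef /\ k = 0%N) \/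
  [/\ ~ has_posdef, reachable k & forall m, reachable m -> (k <= m)%N].

(* [sd_graph d] : d is the maximum of the singularity degrees of P(G, c) over
   all completable c. *)
Definition sd_graph (d : nat) : Prop :=
  (exists2 c, completable c & sd_completion c d) /\
  forall c, completable c -> exists2 k, sd_completion c k & (k <= d)%N.

Lemma sd_completion_uniq c k k' :
  sd_completion c k -> sd_completion c k' -> k = k'.
Proof.
case=> [[p ->]|[p rk mk]] [[p' ->]|[p' rk' mk']] //.
by apply/eqP; rewrite eqn_leq mk ?mk'.
Qed.

Lemma sd_graph_uniq d d' : sd_graph d -> sd_graph d' -> d = d'.
Proof.
move=> [[c Ec cd] ub] [[c' Ec' cd'] ub'].
have [k ck kd'] := ub' _ Ec; have [k' ck' kd] := ub _ Ec'.
move: kd' kd; rewrite (sd_completion_uniq ck cd) (sd_completion_uniq ck' cd').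
by move=> dd' d'd; apply/eqP; rewrite eqn_leq dd'.
Qed.

End Completion.
Arguments sd_graph R {n} e d.

(* Main.v *)
Require Import Defs.
From mathcomp Require Import all_boot all_order all_algebra.
From mathcomp Require Import reals boolp.
From mathcomp Require Import zify ring lra.

(** Chordal graphs have singularity degree at most one.  A chordal graph has a
    simplicial vertex ([chordal_simplicial]), and a completion that is positive
    semidefinite (psd) extends across a simplicial vertex, so by induction a
    partial matrix whose clique blocks are psd has a psd completion
    ([chordal_completion]).  Let [X] be a completion of maximum rank.  For every
    clique [K] let [W K] be the sum of [u u^T] over vectors [u] that span the
    kernel of the block of [X] on [K], and let [W] be the sum of these matrices
    ([clique_stress]).  Then [W] is psd, is supported on the graph and
    annihilates [X], so its kernel contains the image of [X].  Conversely, let [x] be in the kernel of [W].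
    On every clique [x] lies in the image of the block of [X], so for a small
    [t > 0] all clique blocks of [X - t x x^T] remain psd.  A psd completion
    [Z] of this partial matrix gives a second completion [Z + t x x^T] of the
    original problem, whose image contains [x]; its average with [X] has
    no larger rank than [X], so [x] is in the image of [X].  Thus the single stress
    [W] is a certificate ([chordal_certificate]).

    A graph with an induced cycle of length at least four has singularity
    degree at least two.  Put all but two consecutive vertices of the cycle at
    the vector (1, 0) of the plane, the last two at (0, 1) and (3/5, 4/5), and
    the remaining vertices of the graph at vectors orthogonal to the plane and
    to each other; prescribe their inner products along the edges.  Entries
    equal to 1 force rows of a completion to coincide, so the cycle behaves
    like a triangle with three coplanar vectors: every completion annihilates
    3/5 e_0 + 4/5 e_b - e_c, where 0, b and c are vertices at (1, 0), (0, 1)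
    and (3/5, 4/5) ([cycle_ker]).  A psd stress certifying this in one step
    would need a nonzero entry at the vertex c.  But the stress has no entry on
    the chord from 0 to b; the equilibrium condition at 0 then kills its entry
    on the edge from 0 to c, and the one at c kills its diagonal entry at c
    ([cycle_stress]).  Hence e_c is in the kernel of the stress although it is
    not in the image of any completion ([cycle_no_certificate]). *)

Set Implicit Arguments.
Unset Strict Implicit.
Unset Printing Implicit Defensive.

Import Order.TTheory GRing.Theory Num.Theory.
Local Open Scope ring_scope.

(** * Simplicial vertices of chordal graphs *)

Section Simplicial.
Variables (n : nat) (e : rel 'I_n).
Hypotheses (e_sym : symmetric e) (e_irr : irreflexive e).
Implicit Types (A S : {set 'I_n}) (x y b v : 'I_n) (g : nat -> 'I_n).

Definition clique S : bool :=
  [forall i in S, forall j in S, (i != j) ==> e i j].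

Lemma cliqueP S :
  reflect {in S &, forall i j, i != j -> e i j} (clique S).
Proof.
apply: (iffP forall_inP) => [cS i j iS jS|cS i iS].
  by have /forall_inP/(_ j jS)/implyP := cS i iS.
by apply/forall_inP => j jS; apply/implyP; apply: cS.
Qed.

Definition simplicial S v : Prop :=
  v \in S /\ {in S &, forall i j, e v i -> e v j -> i != j -> e i j}.

(** A walk of length [m] is a function on all of [nat], of which only the
    values up to [m] matter; its interior vertices have to be in [A]. *)
Definition walk A x y m g : Prop :=
  [/\ g 0%N = x, g m = y,
      forall i, (i < m)%N -> e (g i) (g i.+1)
    & forall i, (0 < i < m)%N -> g i \in A].

(** Replaces the stretch of the walk from [g i] to [g j] by a single edge when
    [d = 1], and cuts it out when [d = 0] and its endpoints coincide. *)
Lemma walk_shortcut A x y m g i j d :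
  walk A x y m g -> (i < j)%N -> (j <= m)%N -> (d <= 1)%N ->
  (if d == 0%N then g i = g j else e (g i) (g j)) ->
  walk A x y (i + d + (m - j))%N
    (fun t => if (t < i + d)%N then g t else g (t + (j - i) - d)%N).
Proof.
move=> [g0 gm ge gA] ij jm d1 gij; split.
- case: ifP => // Hd; rewrite -g0.
  have [i0 d0] : i = 0%N /\ d = 0%N by lia.
  by move: gij; rewrite d0 i0 /= => ->; congr g; lia.
- case: ifP => [|_]; last by rewrite -gm; congr g; lia.
  by lia.
- move=> t tm; case: ifP => t1; case: ifP => t2.
  + by apply: ge; lia.
  + have E : (t.+1 + (j - i) - d)%N = j by lia.
    case: d d1 gij tm t1 t2 E => [|d] /= d1 gij tm t1 t2 ->.
      rewrite -gij (_ : i = t.+1); last by lia.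
      by apply: ge; lia.
    by rewrite (_ : t = i) //; lia.
  + by lia.
  + rewrite (_ : (t.+1 + (j - i) - d)%N = (t + (j - i) - d)%N.+1); last by lia.
    by apply: ge; lia.
- move=> t tm; case: ifP => t1; first by apply: gA; lia.
  case: (eqVneq (t + (j - i) - d)%N m) => [E|E]; first by lia.
  by apply: gA; lia.
Qed.

(** Repeated vertices and chords give shortcuts, so a walk of least length is
    an induced path. *)
Lemma shortest_walk A x y m g :
  walk A x y m g ->
  exists k h, walk A x y k h /\
    forall i j, (i < j)%N -> (j <= k)%N ->
      h i != h j /\ (e (h i) (h j) -> j = i.+1).
Proof.
elim/ltn_ind: m g => m IH g wg.
have [[i [j [d [h [[ij jm] [d1 dm] gij]]]]]|no] :=
  pselect (exists i j d (_ : True), [/\ (i < j)%N /\ (j <= m)%N,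
    (d <= 1)%N /\ (d < j - i)%N
    & if d == 0%N then g i = g j else e (g i) (g j)]).
  by apply: IH (walk_shortcut wg ij jm d1 gij); lia.
exists m, g; split=> // i j ij jm; split.
  apply/negP => /eqP gij; apply: no; exists i, j, 0%N, I; split=> //.
  by split=> //; lia.
move=> gij; apply/eqP/negPn/negP => E; apply: no; exists i, j, 1%N, I.
by split=> //; split=> //; lia.
Qed.

Definition inner A : rel 'I_n := [rel u v | [&& u \in A, v \in A & e u v]].

Definition connected_in A : Prop := {in A &, forall u v, connect (inner A) u v}.

Definition nbhd A : {set 'I_n} := [set v | [exists u in A, e u v]].

Lemma nbhd_walk A x y :
  connected_in A -> x \in nbhd A -> y \in nbhd A ->
  exists m g, walk A x y m g.
Proof.
move=> cA; rewrite !inE => /exists_inP[u uA ux] /exists_inP[w wA wy].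
have /connectP[p pp lp] := cA _ _ uA wA.
have pA : all (mem A) (u :: p).
  rewrite /= uA /=; elim: p u {ux uA lp} pp => //= z p IH u.
  by case/andP=> /and3P[_ zA _] /IH ->; rewrite zA.
exists (size p).+2, (fun t => nth y (x :: u :: p) t); split=> //=.
- by rewrite nth_default.
- case=> [|i] im /=; first by rewrite e_sym.
  have [ip|pi] := ltnP i (size p).
    by have /(pathP y)/(_ i ip)/and3P[] := pp.
  have /eqP -> : i == size p by move: im; rewrite !ltnS eqn_leq pi andbT.
  by rewrite -[in X in e X _]last_nth -lp nth_default.
- case=> // i im; apply: (allP pA).
  by rewrite /= mem_nth //=; lia.
Qed.

(** If [x] and [y] were not adjacent, a shortest walk between them through [A]
    would have length at least two, and as [b] has no neighbour in [A] it would
    close up through [b] to an induced cycle of length at least four. *)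
Lemma chordal_nbhd_adj A b x y :
  chordal e -> connected_in A -> b \notin A -> b \notin nbhd A ->
  x \in nbhd A -> y \in nbhd A -> x != y ->
  e x b -> e y b -> e x y.
Proof.
move=> ch cA bA bnA xA yA xy xb yb; apply/negPn/negP => nxy; apply: ch.
(* The cycle is [h 0], ..., [h k], [b]. *)
have [m [g /shortest_walk[k [h [[h0 hk he hA] hij]]]]] := nbhd_walk cA xA yA.
have bAE z : z \in A -> e z b = false.
  by move=> zA; apply: contraNF bnA => zb; rewrite inE; apply/exists_inP; exists z.
have k2 : (2 <= k)%N.
  case: k h0 hk he hA hij => [|[|k]] // h0 hk he hA hij.
    by rewrite -h0 -hk eqxx in xy.
  by have := he 0%N isT; rewrite h0 hk (negbTE nxy).
have hb i : (i <= k)%N -> e (h i) b = (i == 0%N) || (i == k).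
  move=> ik; case: eqP => [->|i0]; first by rewrite h0.
  case: eqP => [->|ik']; first by rewrite hk.
  by rewrite bAE // hA //; lia.
have hnb i : (i <= k)%N -> h i != b.
  move=> ik; apply/eqP => hi; have := hb i ik; rewrite hi e_irr.
  move=> /esym/negbT; rewrite negb_or => /andP[i0 ik'].
  by move: bA; rewrite -hi hA //; lia.
have hhE i j : (i <= k)%N -> (j <= k)%N ->
    e (h i) (h j) = (j == i.+1) || (i == j.+1).
  move=> ik jk; case: (ltngtP i j) => ij.
  - rewrite (_ : (i == j.+1) = false) ?orbF; last by lia.
    apply/idP/eqP => [|->]; first exact: (hij i j ij jk).2.
    by apply: he; lia.
  - rewrite (_ : (j == i.+1) = false) //=; last by lia.
    rewrite e_sym; apply/idP/eqP => [|->]; first exact: (hij j i ij ik).2.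
    by apply: he; lia.
  - by rewrite ij e_irr; lia.
have ordSE (i j : 'I_k.+2) :
    (j == ordS i) = if (i <= k)%N then val j == i.+1 else val j == 0%N.
  rewrite -val_eqE /=; case: ifP => ik; first by rewrite modn_small //; lia.
  rewrite (_ : i.+1 = k.+2) ?modnn //.
  by have := ltn_ord i; lia.
exists k.+2, (fun i : 'I_k.+2 => if (i <= k)%N then h i else b); first by [].
split.
  move=> i j; case: ifP => ik; case: ifP => jk.
  - move=> hh; apply: val_inj => /=; case: (ltngtP i j) => // ij.
      by have := (hij i j ij jk).1; rewrite hh eqxx.
    by have := (hij j i ij ik).1; rewrite hh eqxx.
  - by move=> /eqP; rewrite (negbTE (hnb i ik)).
  - by move=> /esym/eqP; rewrite (negbTE (hnb j jk)).
  - by move=> _; apply: val_inj => /=; have := ltn_ord i; have := ltn_ord j; lia.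
move=> i j; rewrite !ordSE; have := ltn_ord i; have := ltn_ord j.
rewrite /=; case: ifP => ik; case: ifP => jk ji ii.
- by rewrite hhE.
- by rewrite hb //; lia.
- by rewrite e_sym hb //; lia.
- by rewrite e_irr; lia.
Qed.

Lemma connected_inU1 A x :
  connected_in A -> x \in nbhd A -> connected_in (x |: A).
Proof.
move=> cA; rewrite inE => /exists_inP[u uA ux].
have sub v w : connect (inner A) v w -> connect (inner (x |: A)) v w.
  apply: connect_sub => {}v {}w /and3P[vA wA vw]; apply: connect1.
  by rewrite /inner /= !inE vA wA vw !orbT.
have xu : connect (inner (x |: A)) x u.
  by apply: connect1; rewrite /inner /= !inE uA orbT eqxx e_sym.
have ux' : connect (inner (x |: A)) u x.
  by apply: connect1; rewrite /inner /= !inE uA orbT eqxx.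
move=> v w; rewrite !inE => /predU1P[->|vA] /predU1P[->|wA] //.
- by apply: connect_trans xu (sub _ _ _); apply: cA.
- by apply: connect_trans (sub _ _ _) ux'; apply: cA.
- by apply: sub; apply: cA.
Qed.

(** If [S] is not a clique, take a largest connected [A] in [S] that does not
    dominate [S].  By maximality every neighbour of [A] is adjacent to all of
    the undominated part [B], and by [chordal_nbhd_adj] the neighbours of [A]
    that see a common vertex of [B] form a clique.  So a simplicial vertex of
    [B], which exists by induction, is simplicial in [S]. *)
Lemma chordal_simplicial S :
  chordal e -> S != set0 -> exists v, simplicial S v.
Proof.
move=> ch; have [N] := ubnP #|S|; elim: N S => // N IH S SN S0.
have [/cliqueP cS|] := boolP (clique S).
  by have [v vS] := set0Pn _ S0; exists v; split=> // i j iS jS _ _; apply: cS.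
move=> /forall_inPn[a aS /forall_inPn[b bS]]; rewrite negb_imply => /andP[ab nab].
pose good A := [&& A != set0, A \subset S & ~~ (S \subset A :|: nbhd A)]
               && `[< connected_in A >].
have ga : good [set a].
  apply/andP; split; last first.
    by apply/asboolP => u v /set1P-> /set1P->; apply: connect0.
  apply/and3P; split; rewrite ?sub1set //; first by apply/set0Pn; exists a; rewrite inE.
  apply/subsetPn; exists b; rewrite // !inE negb_or eq_sym ab /=.
  by apply/exists_inP => -[u /set1P->]; apply/negP.
case: (arg_maxnP (fun A => #|A|) ga) => A /andP[/and3P[A0 AS nSA] /asboolP cA] Amax.
pose B := S :\: (A :|: nbhd A).
have B0 : B != set0.
  have /subsetPn[z zS zA] := nSA; apply/set0Pn; exists z.
  by rewrite !inE in zA *; rewrite zA zS.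
have BS : B \proper S.
  have [z zA] := set0Pn _ A0; apply/properP; split; first exact: subsetDl.
  by exists z; [exact: (subsetP AS)|rewrite !inE zA].
have [v [vB sv]] : exists v, simplicial B v.
  by apply: IH => //; apply: leq_trans (proper_card BS) _.
(* Otherwise [x |: A] would be connected and leave [z] undominated. *)
have NB x z : x \in S -> x \in nbhd A -> x \notin A -> z \in B -> e x z.
  move=> xS xA nxA zB; apply/negPn/negP => nxz.
  have := Amax (x |: A); rewrite /= cardsU1 nxA add1n ltnn => /(_ _)/negP; apply => //.
  apply/andP; split; last by apply/asboolP; apply: connected_inU1.
  apply/and3P; split.
  - by apply/set0Pn; exists x; rewrite setU11.
  - by apply/subsetP => t /setU1P[->//|]; apply: (subsetP AS).
  apply/subsetPn; exists z; first by case/setDP: zB.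
  have /andP[zA znA] : (z \notin A) && (z \notin nbhd A).
    by rewrite -negb_or -in_setU; case/setDP: zB.
  rewrite in_setU in_setU1 !negb_or zA andbT; apply/andP; split.
    by apply: contraNneq znA => ->.
  rewrite inE; apply/exists_inP => -[u /setU1P[->|uA]]; first exact/negP.
  by move=> uz; move: znA; rewrite inE => /exists_inP; apply; exists u.
have vS : v \in S by case/setDP: vB.
have [vA vnA] : v \notin A /\ v \notin nbhd A.
  by move: vB; rewrite in_setD in_setU negb_or => /andP[/andP[]].
exists v; split=> // i j iS jS vi vj ij.
have nb z : e v z -> z \in A = false.
  move=> vz; apply: contraNF vnA => zA.
  by rewrite inE; apply/exists_inP; exists z; rewrite // e_sym.
have inB z : z \in S -> e v z -> z \notin nbhd A -> z \in B.
  by move=> zS vz zA; rewrite in_setD in_setU negb_or zS zA (nb z).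
have [iA|iA] := boolP (i \in nbhd A); have [jA|jA] := boolP (j \in nbhd A).
- by apply: (chordal_nbhd_adj ch cA vA vnA) => //; rewrite e_sym.
- by apply: NB (inB _ _ _ jA) => //; rewrite nb.
- by rewrite e_sym; apply: NB (inB _ _ _ iA) => //; rewrite nb.
- by apply: sv ij => //; apply: inB.
Qed.

End Simplicial.

(** * Positive semidefinite matrices *)

Section Psd.
Variables (R : realType) (n : nat).
Implicit Types (A B X : 'M[R]_n) (x y z : 'cV[R]_n) (K : {set 'I_n}).

Definition bform A x y : R := (x^T *m A *m y) 0 0.

Lemma qformE A x : qform A x = bform A x x. Proof. by []. Qed.

Lemma bformDl A x y z : bform A (x + y) z = bform A x z + bform A y z.
Proof. by rewrite /bform linearD /= !mulmxDl mxE. Qed.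
Lemma bformDr A x y z : bform A z (x + y) = bform A z x + bform A z y.
Proof. by rewrite /bform mulmxDr mxE. Qed.
Lemma bformZl A a x y : bform A (a *: x) y = a * bform A x y.
Proof. by rewrite /bform linearZ /= -!scalemxAl mxE. Qed.
Lemma bformZr A a x y : bform A x (a *: y) = a * bform A x y.
Proof. by rewrite /bform -scalemxAr mxE. Qed.
Lemma bformDm A B x y : bform (A + B) x y = bform A x y + bform B x y.
Proof. by rewrite /bform mulmxDr mulmxDl mxE. Qed.
Lemma bformZm a A x y : bform (a *: A) x y = a * bform A x y.
Proof. by rewrite /bform -scalemxAr -scalemxAl mxE. Qed.
Lemma bform_sum I (r : seq I) (P : pred I) (F : I -> 'M[R]_n) x y :
  bform (\sum_(i <- r | P i) F i) x y = \sum_(i <- r | P i) bform (F i) x y.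
Proof. by rewrite /bform mulmx_sumr mulmx_suml summxE. Qed.
Lemma bformC A x y : A^T = A -> bform A x y = bform A y x.
Proof.
move=> As; rewrite /bform -[RHS]/((y^T *m A *m x) 0 0).
by rewrite -[y^T *m A *m x]trmxK [RHS]mxE !trmx_mul trmxK As mulmxA.
Qed.
Lemma bform_mul A B C x y : bform (B^T *m A *m C) x y = bform A (B *m x) (C *m y).
Proof. by rewrite /bform trmx_mul !mulmxA. Qed.

Lemma bform_delta A i j : bform A (delta_mx i 0) (delta_mx j 0) = A i j.
Proof. by rewrite /bform trmx_delta -rowE -colE !mxE. Qed.
Lemma bform_deltal A i x : bform A (delta_mx i 0) x = (A *m x) i 0.
Proof. by rewrite /bform trmx_delta -rowE -row_mul mxE. Qed.

Lemma bform_outer x y : bform (x *m x^T) y y = (x^T *m y) 0 0 ^+ 2.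
Proof.
rewrite /bform mulmxA -[LHS]/((_ *m _ *m _ *m _) 0 0) -mulmxA mxE big_ord1.
rewrite expr2; congr (_ * _).
by rewrite -[y^T *m x]trmxK mxE trmx_mul trmxK.
Qed.

Lemma qform_lin A a b x y : A^T = A ->
  qform A (a *: x + b *: y) =
  a ^+ 2 * qform A x + 2 * a * b * bform A x y + b ^+ 2 * qform A y.
Proof.
move=> As; rewrite !qformE !(bformDl, bformDr, bformZl, bformZr) (bformC y x As).
ring.
Qed.

Lemma quad_ge0_discr (p b q : R) : 0 <= q ->
  (forall s t, 0 <= s ^+ 2 * p + 2 * s * t * b + t ^+ 2 * q) -> b ^+ 2 <= p * q.
Proof.
move=> q0 H; have H1 := H q (- b).
have H2 : 0 <= q * (p * q - b ^+ 2).
  by rewrite (_ : _ * _ = q ^+ 2 * p + 2 * q * (- b) * b + (- b) ^+ 2 * q) //; ring.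
case: (ltrgtP q 0) => [|qp|q00]; first by rewrite ltNge q0.
  by move: H2; rewrite pmulr_rge0 // subr_ge0.
rewrite q00 mulr0; have [->|b0] := eqVneq b 0; first by rewrite expr0n.
have := H 1 (- (p + 1) / b); rewrite q00 mulr0 addr0 mulr1 expr1n -mulrA divfK //.
by have := H 1 0; rewrite q00; lra.
Qed.

Lemma psd_CS A x y : psd A -> bform A x y ^+ 2 <= qform A x * qform A y.
Proof.
move=> [As A0]; apply: quad_ge0_discr => // s t.
by rewrite -qform_lin.
Qed.

Lemma psd_ker A x : psd A -> qform A x = 0 -> A *m x = 0.
Proof.
move=> pA x0; apply/colP => i; rewrite -bform_deltal [RHS]mxE; apply/eqP.
by rewrite -sqrf_eq0 eq_le sqr_ge0 andbT (le_trans (psd_CS _ _ pA)) // x0 mulr0.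
Qed.

Lemma qform_ker A x : A *m x = 0 -> qform A x = 0.
Proof. by move=> x0; rewrite /qform -mulmxA x0 mulmx0 mxE. Qed.

Lemma psdD A B : psd A -> psd B -> psd (A + B).
Proof.
move=> [As A0] [Bs B0]; split; first by rewrite linearD /= As Bs.
by move=> x; rewrite qformE bformDm addr_ge0 // ?A0 ?B0.
Qed.

Lemma psdZ a A : 0 <= a -> psd A -> psd (a *: A).
Proof.
move=> a0 [As A0]; split; first by rewrite linearZ /= As.
by move=> x; rewrite qformE bformZm mulr_ge0 // A0.
Qed.

Lemma psd0 : psd (0 : 'M[R]_n).
Proof. by split=> [|x]; rewrite ?trmx0 // qform_ker // mul0mx. Qed.

Lemma psd_sum I (r : seq I) (P : pred I) (F : I -> 'M[R]_n) :
  (forall i, P i -> psd (F i)) -> psd (\sum_(i <- r | P i) F i).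
Proof.
by move=> pF; apply: (big_ind (fun A => psd A)) => //; [exact: psd0|exact: psdD].
Qed.

Lemma psd_congr A B : psd A -> psd (B^T *m A *m B).
Proof.
move=> [As A0]; split; first by rewrite !trmx_mul trmxK As mulmxA.
by move=> x; rewrite qformE bform_mul A0.
Qed.

Lemma psd_gram m (B : 'M[R]_(m, n)) : psd (B^T *m B).
Proof.
split; first by rewrite trmx_mul trmxK.
move=> x; rewrite /qform mulmxA -mulmxA -trmx_mul mxE sumr_ge0 // => i _.
by rewrite mxE -expr2 sqr_ge0.
Qed.

Lemma qform_gram0 m (B : 'M[R]_(m, n)) x : qform (B^T *m B) x = 0 -> B *m x = 0.
Proof.
rewrite /qform mulmxA -mulmxA -trmx_mul mxE => /eqP.
rewrite psumr_eq0 => [/allP H|i _]; last by rewrite mxE -expr2 sqr_ge0.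
apply/colP => i; have := H i (mem_index_enum _).
by rewrite mxE -expr2 sqrf_eq0 /= [in RHS]mxE => /eqP.
Qed.

Lemma psd_outer x : psd (x *m x^T).
Proof. by have := psd_gram x^T; rewrite trmxK. Qed.

(** The image of a symmetric matrix is the orthogonal complement of its
    kernel; the columns of [cokermx A] span that kernel. *)
Lemma sym_image A (b : 'cV[R]_n) : A^T = A ->
  (forall z, A *m z = 0 -> (z^T *m b) 0 0 = 0) -> exists y, b = A *m y.
Proof.
move=> As H; have /submxP[D bD] : (b^T <= A)%MS.
  have C0 : (cokermx A)^T *m b = 0.
    apply/colP => j; rewrite [RHS]mxE -(H (col j (cokermx A))); last first.
      by rewrite colE mulmxA mulmx_coker mul0mx.
    by rewrite !mxE; apply: eq_bigr => k _; rewrite !mxE.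
  by rewrite submxE -[_ *m _]trmxK trmx_mul trmxK C0 trmx0.
by exists D^T; rewrite -[b]trmxK bD trmx_mul As.
Qed.

(** Subtracting from [X] the outer square of its [i]-th column, divided by
    [X i i], leaves a psd matrix by Cauchy-Schwarz and clears the [i]-th
    diagonal entry; zero diagonal entries stay zero.  When the diagonal
    vanishes, so does the matrix. *)
Lemma psd_decomp X : psd X ->
  exists r (f : 'I_r -> 'cV[R]_n), X = \sum_i f i *m (f i)^T.
Proof.
have [N] := ubnP #|[set i | X i i != 0]|; elim: N X => // N IH X XN pX.
have dge j : 0 <= X j j by rewrite -bform_delta; apply: pX.2.
have [d0|/forallPn[i Xi]] := boolP [forall i, X i i == 0].
  exists 0%N, (fun=> 0); rewrite big_ord0.
  apply/matrixP => i j; rewrite -[LHS]bform_delta /bform -mulmxA.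
  rewrite (psd_ker pX) ?mulmx0 ?mxE //.
  by rewrite qformE bform_delta; apply/eqP/(forallP d0).
have Xi0 : 0 < X i i by rewrite lt_neqAle eq_sym Xi dge.
pose u := X *m delta_mx i 0 : 'cV[R]_n.
pose X' : 'M[R]_n := X - (X i i)^-1 *: (u *m u^T).
have uE x : (u^T *m x) 0 0 = bform X (delta_mx i 0) x.
  by rewrite /u /bform trmx_mul pX.1.
have pX' : psd X'.
  split; first by rewrite linearB /= linearZ /= trmx_mul trmxK pX.1.
  move=> x; rewrite qformE /X' -scaleNr bformDm bformZm bform_outer uE.
  rewrite mulNr subr_ge0 mulrC ler_pdivrMr // mulrC.
  by have := psd_CS (delta_mx i 0) x pX; rewrite {1}qformE bform_delta.
have X'E j : X' j j = X j j - (X i i)^-1 * X i j ^+ 2.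
  rewrite -bform_delta /X' -scaleNr bformDm bformZm bform_outer uE !bform_delta.
  by rewrite mulNr.
have [|r [f X'f]] := IH X' _ pX'.
  rewrite -ltnS; apply: leq_trans XN; rewrite ltnS; apply: proper_card.
  apply/properP; split.
    apply/subsetP => j; rewrite !inE; apply: contraNneq => Xj0; apply/eqP/le_anti.
    apply/andP; split; last by rewrite -bform_delta; apply: pX'.2.
    by rewrite X'E Xj0 sub0r oppr_le0 mulr_ge0 ?sqr_ge0 ?invr_ge0 ?ltW.
  exists i; rewrite !inE // X'E negbK expr2 mulrA mulVf ?mul1r ?subrr //.
exists r.+1, (fun j => if unlift ord0 j is Some k then f k
                       else Num.sqrt (X i i)^-1 *: u).
rewrite big_ord_recl unlift_none; under eq_bigr => k _ do rewrite liftK.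
rewrite -X'f linearZ /= -scalemxAl -scalemxAr scalerA -expr2 sqr_sqrtr.
  by rewrite /X' addrC subrK.
by rewrite invr_ge0 ltW.
Qed.

Lemma psd_trace0 A X : psd A -> psd X -> \tr (A *m X) <= 0 -> A *m X = 0.
Proof.
move=> pA /psd_decomp[r [f ->]]; rewrite mulmx_sumr raddf_sum /=.
have trE i : \tr (A *m (f i *m (f i)^T)) = qform A (f i).
  by rewrite mulmxA mxtrace_mulC mulmxA trace_mx11.
under eq_bigr => i _ do rewrite trE.
move=> H; have /allP H0 : all (fun i => true ==> (qform A (f i) == 0)) (index_enum 'I_r).
  rewrite -psumr_eq0; last by move=> i _; apply: pA.2.
  by rewrite eq_le H sumr_ge0 // => i _; apply: pA.2.
apply: big1 => i _; rewrite mulmxA (psd_ker pA) ?mul0mx //.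
by apply/eqP; apply: (H0 i (mem_index_enum _)).
Qed.

Lemma psd_full_rank A : psd A -> (n <= \rank A)%N -> posdef A.
Proof.
move=> pA rA; have uA : A \in unitmx by rewrite -row_free_unit -row_leq_rank.
split=> [|x x0]; first exact: pA.1.
rewrite lt_neqAle pA.2 andbT eq_sym; apply: contraNneq x0 => q0.
by rewrite -(mulKmx uA x) (psd_ker pA q0) mulmx0.
Qed.

(** The factor [col_base X] is injective and has the same image as [X]. *)
Lemma is_dim_image X : is_dim (fun x => exists y, x = X *m y) (\rank X).
Proof.
pose g := linfun (mulmx (col_base X) : 'cV[R]_(\rank X) -> 'cV[R]_n).
exists (limg g).
  move=> x; split=> [/memv_imgP[y _ ->]|[y ->]].
    rewrite lfunE /=; exists (pinvmx (row_base X) *m y).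
    transitivity (col_base X *m row_base X *m (pinvmx (row_base X) *m y)).
      by rewrite -mulmxA (mulmxA (row_base X)) mulmxVp ?mul1mx // row_base_free.
    by rewrite mulmx_base.
  have := memv_img g (memvf (row_base X *m y)).
  by rewrite lfunE /= mulmxA mulmx_base.
rewrite limg_dim_eq ?dimvf /dim /= ?muln1 //.
apply/eqP; rewrite capfv; apply/eqP/vspaceP => y.
rewrite memv_ker memv0 lfunE /= -(mulmx0 _ (col_base X)).
by apply/eqP/eqP => [/row_full_inj->|->] //; apply: col_base_full.
Qed.
End Psd.

(** * Completing a partial matrix over a chordal graph *)

Section Completions.
Variables (R : realType) (n : nat).
Implicit Types (A B X Z : 'M[R]_n) (x y z : 'cV[R]_n) (K S : {set 'I_n}).

Definition proj K : 'M[R]_n := diag_mx (\row_i (i \in K)%:R).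
(** The principal block of [A] on [K], kept as an [n x n] matrix with zeros
    elsewhere so that blocks for different [K] live in one space. *)
Definition compress K A : 'M[R]_n := (proj K)^T *m A *m proj K.

Lemma projE K x i : (proj K *m x) i 0 = if i \in K then x i 0 else 0.
Proof. by rewrite mul_diag_mx !mxE; case: ifP; rewrite ?mul1r ?mul0r. Qed.

Lemma proj_id K x : (forall i, i \notin K -> x i 0 = 0) -> proj K *m x = x.
Proof. by move=> x0; apply/colP => i; rewrite projE; case: ifPn => // /x0. Qed.

Lemma proj_tr K : (proj K)^T = proj K.
Proof. exact: tr_diag_mx. Qed.

Lemma qform_compress K A x : qform (compress K A) x = qform A (proj K *m x).
Proof. by rewrite /compress !qformE bform_mul. Qed.

Lemma bformE A x y : bform A x y = \sum_i x i 0 * (A *m y) i 0.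
Proof. by rewrite /bform -mulmxA mxE; apply: eq_bigr => i _; rewrite mxE. Qed.

(** Column [v] of [A] on [K] is in the image of the block of [A] on [K], say
    [A y] with [y] supported on [K].  The form [Z' (x - x_v e_v + x_v y)], which
    treats the new vertex as the combination [y] of the old ones, has the
    right entries except at [(v, v)], where the missing amount [c] is a Schur
    complement, hence nonnegative. *)
Lemma simplicial_extend A Z' K v :
  A^T = A -> v \notin K -> psd (compress (v |: K) A) -> psd Z' ->
  {in K &, forall i j, Z' i j = A i j} ->
  exists Z, [/\ psd Z, Z v v = A v v,
    forall i j, i != v -> j != v -> Z i j = Z' i j
    & forall i, i \in K -> Z i v = A i v].
Proof.
move=> As vK pM pZ' ZA.
pose ev : 'cV[R]_n := delta_mx v 0.
pose b := proj K *m (A *m ev).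
have [y0 by0] : exists y0, b = compress K A *m y0.
  apply: sym_image => [|z Bz].
    by rewrite /compress proj_tr !trmx_mul proj_tr As mulmxA.
  pose z' := proj K *m z.
  have z'K : proj (v |: K) *m z' = z'.
    by apply: proj_id => i; rewrite in_setU1 negb_or projE => /andP[_ /negbTE->].
  have q0 : qform (compress (v |: K) A) z' = 0.
    by rewrite qform_compress z'K -qform_compress qform_ker.
  have /(congr1 (fun u : 'cV_n => u v 0)) := psd_ker pM q0.
  rewrite /compress proj_tr -!mulmxA z'K projE setU11 [RHS]mxE -bform_deltal => <-.
  by rewrite (bformC _ _ As) /b mulmxA -{1}proj_tr -trmx_mul /bform mulmxA.
pose y := proj K *m y0.
have yK i : i \notin K -> y i 0 = 0 by rewrite projE => /negbTE->.
have yA i : i \in K -> (A *m y) i 0 = A i v.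
  move=> iK; have /(congr1 (fun u : 'cV_n => u i 0)) := by0.
  rewrite /compress proj_tr -!mulmxA !projE iK -/y => <-.
  by rewrite -bform_deltal bform_delta.
move: y yK yA => y yK yA.
have Z'y i : i \in K -> (Z' *m y) i 0 = A i v.
  move=> iK; rewrite -(yA _ iK) !mxE; apply: eq_bigr => k _.
  by have [kK|/yK->] := boolP (k \in K); rewrite ?mulr0 // ZA.
pose c := A v v - qform Z' y.
have c0 : 0 <= c.
  have qyv : qform A y = bform A y ev.
    rewrite qformE !bformE; apply: eq_bigr => i _.
    have [iK|/yK->] := boolP (i \in K); last by rewrite !mul0r.
    by rewrite (yA _ iK) -[in RHS]bform_deltal bform_delta.
  rewrite /c; have -> : qform Z' y = qform A y.
    rewrite !qformE !bformE; apply: eq_bigr => i _.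
    have [iK|/yK->] := boolP (i \in K); last by rewrite !mul0r.
    by rewrite Z'y // yA.
  have := pM.2 (1 *: ev + (-1) *: y); rewrite qform_compress proj_id; last first.
    move=> i; rewrite in_setU1 negb_or => /andP[iv /yK iK].
    by rewrite !mxE (negbTE iv) iK !mulr0 addr0.
  rewrite qform_lin // (bformC _ _ As) -qyv {1}qformE bform_delta => H.
  by lra.
pose L : 'M[R]_n := 1%:M + (y - ev) *m ev^T.
have LE j : L *m delta_mx j 0 = if j == v then y else delta_mx j 0.
  rewrite mulmxDl mul1mx -mulmxA trmx_delta mul_delta_mx_cond eq_sym.
  case: eqP => [->|_]; last by rewrite mulr0n mulmx0 addr0.
  rewrite mulr1n (_ : delta_mx 0 0 = 1%:M); last first.
    by apply/matrixP => i j'; rewrite !ord1 !mxE.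
  by rewrite mulmx1 addrC subrK.
pose Z := L^T *m Z' *m L + c *: (ev *m ev^T).
have ZE i j : Z i j = bform Z' (L *m delta_mx i 0) (L *m delta_mx j 0)
                      + c * ((i == v)%:R * (j == v)%:R).
  rewrite -bform_delta bformDm bform_mul bformZm; congr (_ + c * _).
  by rewrite bform_delta mxE big_ord1 !mxE !eqxx !andbT.
exists Z; split.
- by apply: psdD; [exact: psd_congr|apply: psdZ; [exact: c0|exact: psd_outer]].
- by rewrite ZE !LE !eqxx -qformE /c !mulr1 addrC subrK.
- by move=> i j /negbTE iv /negbTE jv; rewrite ZE !LE iv jv bform_delta mul0r mulr0 addr0.
move=> i iK; rewrite ZE !LE eqxx.
have /negbTE-> : i != v by apply: contraNneq vK => <-.
by rewrite mul0r mulr0 addr0 bform_deltal Z'y.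
Qed.

Variable e : rel 'I_n.
Hypotheses (e_sym : symmetric e) (e_irr : irreflexive e).

(** Induction on the set of completed vertices, adding a simplicial vertex [v]
    last: with its neighbours it forms a clique, so [simplicial_extend]
    applies.  Entries of [Z] outside [S] are arbitrary. *)
Lemma chordal_completion A : chordal e -> A^T = A ->
  (forall K, clique e K -> psd (compress K A)) ->
  exists2 Z, psd Z & forall i j, (i == j) || e i j -> Z i j = A i j.
Proof.
move=> ch As pA.
suff /(_ setT)[Z pZ ZA] : forall S, exists2 Z, psd Z &
    {in S &, forall i j, (i == j) || e i j -> Z i j = A i j}.
  by exists Z => // i j; apply: ZA; rewrite inE.
move=> S; have [N] := ubnP #|S|; elim: N S => // N IH S SN.
have [->|S0] := eqVneq S set0; first by exists 0; [exact: psd0|move=> i j; rewrite inE].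
have [v [vS sv]] := chordal_simplicial e_sym e_irr ch S0.
have [|Z' pZ' Z'A] := IH (S :\ v).
  by rewrite -ltnS (leq_trans _ SN) // [in X in (_ < X)%N](cardsD1 v) vS.
pose K := [set i in S | e v i].
have Kadj : {in K &, forall i j, i != j -> e i j}.
  by move=> i j; rewrite !inE => /andP[iS vi] /andP[jS vj]; apply: sv.
have KS i : i \in K -> i \in S :\ v.
  rewrite !inE => /andP[-> vi]; rewrite andbT; apply: contraTneq vi => ->.
  by rewrite e_irr.
have vK : v \notin K by rewrite inE e_irr andbF.
have cK : clique e (v |: K).
  apply/cliqueP => i j /setU1P[->|iK] /setU1P[->|jK]; rewrite ?eqxx // => ij.
  - by move: jK; rewrite inE => /andP[].
  - by rewrite e_sym; move: iK; rewrite inE => /andP[].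
  - exact: Kadj.
have [|Z [pZ Zv ZZ' ZK]] := simplicial_extend As vK (pA _ cK) pZ'.
  move=> i j iK jK; apply: Z'A; rewrite ?KS //.
  by have [//|ij] := eqVneq i j; rewrite Kadj.
have AC i j : A i j = A j i by rewrite -{1}As mxE.
have ZC i j : Z i j = Z j i by rewrite -{1}pZ.1 mxE.
exists Z => // i j iS jS; have [->|iv] := eqVneq i v; have [->|jv] := eqVneq j v => //.
- by move=> /= vj; rewrite ZC AC ZK // inE jS.
- by rewrite (negbTE iv) /= e_sym => vi; rewrite ZK // inE iS.
- by move=> ij; rewrite ZZ' // Z'A // !inE ?iv ?jv.
Qed.

(** [W] is the sum of [u u^T] over vectors [u] that span the kernel of the block
    of [X] on [K].
    If [W] vanishes at [x], then [x] restricted to [K] is orthogonal to that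
    kernel, hence is in the image of the block, say of [z]; by Cauchy-Schwarz
    the block dominates [t x x^T] on [K] as long as [t z^T X z <= 1]. *)
Lemma clique_stress X K : psd X ->
  exists W : 'M[R]_n, [/\ psd W, forall i j, ~~ ((i \in K) && (j \in K)) -> W i j = 0,
    W *m X = 0 &
    forall x, qform W x = 0 -> exists2 m, 0 <= m & forall t, 0 <= t -> t * m <= 1 ->
      psd (compress K (X - t *: (x *m x^T)))].
Proof.
move=> pX; pose M := compress K X; have pM : psd M by exact: psd_congr.
pose U := (kermx M)*m proj K.
have UX : U *m X *m U^T = 0.
  have -> : U *m X *m U^T = kermx M *m M *m (kermx M)^T.
    by rewrite /U /M /compress trmx_mul !mulmxA proj_tr.
  by rewrite mulmx_ker mul0mx.
exists (U^T *m U); split.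
- exact: psd_gram.
- move=> i j ij; rewrite -bform_delta -[_ *m _]mulmx1 -mulmxA [U *m 1%:M]mulmx1.
  have Uz k : k \notin K -> U *m delta_mx k 0 = 0 :> 'cV_n.
    move=> kK; rewrite /U -mulmxA (_ : proj K *m _ = 0) ?mulmx0 //.
    apply/colP => l; rewrite projE !mxE; case: ifP => // lK.
    by case: eqP lK kK => // -> ->.
  rewrite -[U^T]mulmx1 bform_mul; move: ij; rewrite negb_and => /orP[] /Uz ->.
    by rewrite /bform trmx0 !mul0mx mxE.
  by rewrite /bform mulmx0 mxE.
- have UXr : X *m U^T = 0.
    apply/matrixP => j i; rewrite [RHS]mxE.
    have -> : (X *m U^T) j i = (X *m (U^T *m delta_mx i 0) : 'cV_n) j 0.
      by rewrite mulmxA -colE [RHS]mxE.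
    rewrite (psd_ker pX); first by rewrite mxE.
    rewrite qformE -bform_mul trmxK UX.
    by rewrite /bform mulmx0 mul0mx mxE.
  apply: trmx_inj; rewrite (trmx_mul _ X) (trmx_mul _ U) trmxK pX.1 mulmxA.
  by rewrite UXr mul0mx trmx0.
move=> x /qform_gram0 Ux.
have [z xz] : exists z, proj K *m x = M *m z.
  apply: sym_image => [|w Mw]; first exact: pM.1.
  have /submxP[D wD] : (w^T <= kermx M)%MS.
    by apply/sub_kermxP; rewrite -[M]pM.1 -trmx_mul Mw trmx0.
  by rewrite wD -mulmxA (mulmxA (kermx M)) -/U Ux mulmx0 mxE.
exists (qform M z); first exact: pM.2.
move=> t t0 tm; split.
  rewrite /compress !trmx_mul linearB /= linearZ /= trmx_mul !trmxK pX.1.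
  by rewrite mulmxA.
move=> y; rewrite qform_compress qformE -scaleNr bformDm bformZm bform_outer.
rewrite -qformE -qform_compress -/M mulNr subr_ge0.
have -> : (x^T *m (proj K *m y)) 0 0 = bform M z y.
  by rewrite mulmxA -{1}proj_tr -trmx_mul xz trmx_mul pM.1.
apply: le_trans (ler_wpM2l t0 (psd_CS z y pM)) _; rewrite mulrA.
by rewrite ler_piMl // pM.2.
Qed.

End Completions.

(** * Stress matrices *)

Section Stress.
Variables (R : realType) (n : nat) (e : rel 'I_n).
Hypotheses (e_sym : symmetric e) (e_irr : irreflexive e).
Implicit Types (X W : 'M[R]_n) (x y z : 'cV[R]_n) (w : stress R e).

Lemma EmxE (i j k l : 'I_n) :
  Emx R i j k l = 2^-1 * (((k == i) && (l == j))%:R + ((k == j) && (l == i))%:R) :> R.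
Proof. by rewrite !mxE. Qed.

Lemma Emx_sym (i j : 'I_n) : (Emx R i j)^T = Emx R i j.
Proof. by rewrite /Emx linearZ linearD /= !trmx_delta addrC. Qed.

Lemma mxtrace_Emx (i j : 'I_n) X : X^T = X -> \tr (Emx R i j *m X) = X i j.
Proof.
move=> Xs; have tr k l : \tr (delta_mx k l *m X) = X l k.
  rewrite -(mul_delta_mx (0 : 'I_1)) -mulmxA mxtrace_mulC -rowE trace_mx11.
  by rewrite -colE !mxE.
rewrite /Emx -scalemxAl mxtraceZ mulmxDl mxtraceD !tr -{1}Xs mxE.
by field.
Qed.

Lemma stress_mx_sym w : (stress_mx w)^T = stress_mx w.
Proof.
rewrite linearD /= !linear_sum /=; congr (_ + _);
by apply: eq_bigr => i _; rewrite linearZ /= Emx_sym.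
Qed.

Lemma stress_mx_nonedge w i j : i != j -> ~~ e i j -> stress_mx w i j = 0.
Proof.
move=> ij nij; rewrite mxE !summxE !big1 ?addr0 // => [[[a b] uP] _|k _];
  rewrite mxE EmxE /=.
  have /andP[_ /= ab] := uP.
  case: eqP => [ia|_]; case: eqP => [jb|_]; case: eqP => [ib|_]; case: eqP => [ja|_];
    rewrite /= ?addr0 ?mulr0 //;
    by [rewrite ia jb ab in nij | rewrite ja ib e_sym ab in nij].
case: eqP => [ik|_]; case: eqP => [jk|_]; rewrite /= ?addr0 ?mulr0 //.
by rewrite ik jk eqxx in ij.
Qed.

Lemma stress_mx_trace w X : X^T = X ->
  \tr (stress_mx w *m X) =
  \sum_(i < n) w (inl i) * X i i +
  \sum_(u : edge e) w (inr u) * X (val u).1 (val u).2.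
Proof.
move=> Xs; rewrite mulmxDl mxtraceD !mulmx_suml !raddf_sum /=.
by congr (_ + _); apply: eq_bigr => i _; rewrite -scalemxAl mxtraceZ mxtrace_Emx.
Qed.

Lemma stress_mx_surj W : W^T = W -> (forall i j, i != j -> ~~ e i j -> W i j = 0) ->
  exists w, stress_mx w = W.
Proof.
move=> Ws W0.
pose w : stress R e := fun s => match s with
  | inl i => W i i | inr u => 2 * W (val u).1 (val u).2 end.
exists w; suff lt_eq (i j : 'I_n) : (i <= j)%N -> stress_mx w i j = W i j.
  apply/matrixP => i j; have [/lt_eq//|/ltnW/lt_eq] := leqP i j.
  by rewrite -{1}stress_mx_sym -{1}Ws [LHS]mxE [RHS]mxE.
rewrite leq_eqVlt => /predU1P[/val_inj <-|ij].
  rewrite mxE !summxE (bigD1 i) //= !big1 ?addr0.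
  - by rewrite mxE EmxE !eqxx /=; field.
  - move=> [[a b] uP] _; rewrite mxE EmxE /=; have /andP[/= ab _] := uP.
    case: eqP => [ia|_]; case: eqP => [ib|_]; rewrite /= ?addr0 ?mulr0 //.
    by rewrite -ia -ib ltnn in ab.
  - by move=> k ki; rewrite mxE EmxE eq_sym (negbTE ki) /= addr0 !mulr0.
have ji : (j == i) = false by apply/negbTE; rewrite neq_ltn ij orbT.
have [eij|nij] := boolP (e i j); last first.
  by rewrite stress_mx_nonedge ?W0 // eq_sym ji.
have uP : (val (i, j).1 < val (i, j).2)%N && e (i, j).1 (i, j).2 by rewrite /= ij.
rewrite mxE !summxE (bigD1 (exist _ (i, j) uP : edge e)) //= !big1 ?add0r ?addr0.
- by rewrite mxE EmxE /= !eqxx ji andbF addr0 /=; field.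
- move=> u uij; have : val u != (i, j) by apply: contraNneq uij => E; apply/eqP/val_inj.
  case: u {uij} => -[a b] abP /= uab; rewrite mxE EmxE /=.
  have /andP[/= ab _] := abP.
  case: eqP => [ia|_]; case: eqP => [jb|_]; case: eqP => [ib|_]; case: eqP => [ja|_];
    rewrite /= ?addr0 ?mulr0 //;
    by [rewrite ia jb eqxx in uab | move: ij; rewrite ib ja ltnNge ltnW].
- move=> k _; rewrite mxE EmxE; case: eqP => [ik|_]; last by rewrite /= addr0 !mulr0.
  by rewrite -ik ji /= addr0 !mulr0.
Qed.

Lemma feasible_tr (c : edge e -> R) X w : feasible c X ->
  \tr (stress_mx w *m X) =
  \sum_(i < n) w (inl i) + \sum_(u : edge e) w (inr u) * c u.
Proof.
move=> [[Xs _] X1 Xc]; rewrite stress_mx_trace //; congr (_ + _); apply: eq_bigr => i _.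
  by rewrite X1 mulr1.
by rewrite Xc.
Qed.

Lemma max_rank_exists (c : edge e -> R) X : feasible c X -> exists s, max_rank c s.
Proof.
move=> fX; pose P s := `[< exists2 X, feasible c X & \rank X = s >].
have exP : exists s, P s by exists (\rank X); apply/asboolP; exists X.
have ubP s : P s -> (s <= n)%N by move=> /asboolP[Y _ <-]; apply: rank_leq_row.
case: (ex_maxnP exP ubP) => s /asboolP Ps maxs; exists s; split=> // Y fY.
by apply: maxs; apply/asboolP; exists Y.
Qed.

(** The kernel of [X + Y] is the intersection of the two kernels, so the row
    space of [X + Y] contains that of [X], and equals it when the ranks do. *)
Lemma psd_rank_ker X Y z : psd X -> psd Y -> (\rank (X + Y)%R <= \rank X)%N ->
  X *m z = 0 -> Y *m z = 0.
Proof.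
move=> pX pY rXY Xz.
have subX : (X <= (X + Y)%R)%MS.
  rewrite submxE; apply/eqP/matrixP => j i; rewrite [RHS]mxE.
  pose u : 'cV_n := cokermx (X + Y)%R *m delta_mx i 0.
  have qu : qform X u + qform Y u = 0.
    rewrite -bformDm -qformE qform_ker // /u mulmxA mulmx_coker mul0mx //.
  have : X *m u = 0.
    apply: psd_ker => //; apply: le_anti; rewrite pX.2 andbT.
    by have := pY.2 u; lra.
  rewrite /u mulmxA -colE => /(congr1 (fun v : 'cV_n => v j 0)).
  by rewrite [LHS]mxE [RHS]mxE.
have [_ eqr] := mxrank_leqif_sup subX.
have : ((X + Y)%R <= X)%MS by rewrite -eqr eqn_leq rXY mxrankS.
case/submxP => D DX; have : (X + Y) *m z = 0 by rewrite DX -mulmxA Xz mulmx0.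
by rewrite mulmxDl Xz add0r.
Qed.

(** The sum of the clique stresses of a completion of maximum rank. *)
Lemma chordal_certificate (c : edge e -> R) X0 : chordal e -> feasible c X0 ->
  exists w : 'I_1 -> stress R e, certificate c w.
Proof.
move=> ch /max_rank_exists[s ms]; have [[X fX rX] maxX] := ms.
have [pX X1 Xc] := fX; have XC i j : X i j = X j i by rewrite -{1}pX.1 mxE.
have [Wf WfP] := fin_all_exists (fun K => clique_stress K pX).
pose W := \sum_(K | clique e K) Wf K.
have pW : psd W by apply: psd_sum => K _; case: (WfP K).
have WX : W *m X = 0 by rewrite mulmx_suml big1 // => K _; case: (WfP K).
have [w1 w1W] : exists w, stress_mx w = W.
  apply: stress_mx_surj => [|i j ij nij]; first exact: pW.1.
  rewrite summxE big1 // => K /cliqueP cK; case: (WfP K) => _ W0 _ _.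
  by rewrite W0 //; apply: contraNN nij => /andP[iK jK]; apply: cK.
exists (fun=> w1); split; rewrite ?w1W.
- by move=> j x _; apply: pW.2.
- by move=> _; rewrite -(feasible_tr _ fX) w1W WX mxtrace0.
exists s => //; have [U UX dU] := is_dim_image X; exists U; last by rewrite dU.
have VW x : Vset (fun _ : 'I_1 => w1) 1 x <-> qform W x = 0.
  by rewrite -w1W; split=> [/(_ ord0 isT)|? ? ?].
move=> x; apply: (iff_trans (UX x)); apply: iff_trans (iff_sym (VW x)).
split=> [[y ->]|Wx]; first by rewrite qform_ker // mulmxA WX mul0mx.
have [m mP] : exists m, forall K, 0 <= m K /\ (clique e K ->
    forall t, 0 <= t -> t * m K <= 1 -> psd (compress K (X - t *: (x *m x^T)))).
  apply: (@fin_all_exists _ (fun=> R) (fun K mK => 0 <= mK /\ (clique e K ->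
    forall t, 0 <= t -> t * mK <= 1 -> psd (compress K (X - t *: (x *m x^T)))))) => K.
  have [cK|] := boolP (clique e K); last by exists 0.
  have [_ _ _ /(_ x)[|mK mK0 mKP]] := WfP K.
    apply/eqP; have /eqP := Wx; rewrite qformE bform_sum psumr_eq0.
      by move=> /allP/(_ K (mem_index_enum _)); rewrite cK.
    by move=> K' _; case: (WfP K') => pK' _ _ _; apply: pK'.2.
  by exists mK.
(* Small enough for all cliques at once. *)
pose t : R := (1 + \sum_K m K)^-1.
have m0 K : 0 <= m K by case: (mP K).
have s0 : 0 < 1 + \sum_K m K by rewrite ltr_pwDl // sumr_ge0.
have t0 : 0 < t by rewrite invr_gt0.
pose A := X - t *: (x *m x^T).
have [|K cK|Z pZ ZA] := chordal_completion e_sym e_irr ch (A := A).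
- by rewrite linearB /= linearZ /= trmx_mul trmxK pX.1.
- case: (mP K) => _; apply => //; first exact: ltW.
  rewrite mulrC ler_pdivrMr // mul1r (bigD1 K) //=.
  by rewrite addrCA lerDl addr_ge0 // sumr_ge0.
pose Y := Z + t *: (x *m x^T).
have XA : A + t *: (x *m x^T) = X by rewrite subrK.
have YX i j : (i == j) || e i j -> Y i j = X i j.
  by move=> /ZA ZAij; rewrite -[in RHS]XA [LHS]mxE ZAij [RHS]mxE.
have pY : psd Y by apply: psdD pZ (psdZ (ltW t0) (psd_outer x)).
have fH : feasible c (2^-1 *: (X + Y)).
  split; first by apply: psdZ (psdD pX pY); rewrite invr_ge0.
    by move=> i; rewrite mxE [in LHS]mxE YX ?eqxx // X1; field.
  move=> u; rewrite mxE [in LHS]mxE YX ?Xc; first by field.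
  by case/andP: (valP u) => _ ->; rewrite orbT.
have rXY : (\rank (X + Y)%R <= \rank X)%N.
  have h0 : 2^-1 != 0 :> R by rewrite invr_eq0 pnatr_eq0.
  by rewrite rX -(eqmx_scale _ h0) maxX.
apply: sym_image => [|z Xz]; first exact: pX.1.
have := qform_ker (psd_rank_ker pX pY rXY Xz).
rewrite qformE bformDm bformZm bform_outer => q0.
have := pZ.2 z; rewrite qformE => qZ.
have : (x^T *m z) 0 0 == 0.
  rewrite -sqrf_eq0 eq_le sqr_ge0 andbT -(pmulr_rle0 _ t0); lra.
move=> /eqP xz; have -> : z^T *m x = (x^T *m z)^T by rewrite trmx_mul trmxK.
by rewrite mxE.
Qed.

End Stress.

(** * Long induced cycles *)

Section Cycle.
Variables (R : realType) (n : nat) (e : rel 'I_n).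
Hypotheses (e_sym : symmetric e) (e_irr : irreflexive e).
Implicit Types (X W : 'M[R]_n).

Lemma feasible_edge (c : edge e -> R) X Y i j :
  feasible c X -> feasible c Y -> e i j -> X i j = Y i j.
Proof.
move=> [[Xs _] _ Xc] [[Ys _] _ Yc].
wlog ij : i j / (i < j)%N => [H eij|eij].
  have [|ji|/val_inj ij] := ltngtP i j; first by move/H; apply.
    by rewrite -Xs -Ys [LHS]mxE [RHS]mxE; apply: H; rewrite // e_sym.
  by rewrite ij e_irr in eij.
have uP : (val (i, j).1 < val (i, j).2)%N && e (i, j).1 (i, j).2 by rewrite /= ij.
by have := Xc (exist _ (i, j) uP); rewrite -Yc.
Qed.

Lemma psd_entry_bound X i j : psd X -> X i i = 1 -> X j j = 1 -> -1 <= X i j <= 1.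
Proof.
move=> pX Xi Xj; have := psd_CS (delta_mx i 0) (delta_mx j 0) pX.
by rewrite !qformE !bform_delta Xi Xj mulr1 => H; apply/andP; split; nra.
Qed.

(** Unit vectors with inner product 1 coincide. *)
Lemma psd_entry1_row X i j k :
  psd X -> X i i = 1 -> X j j = 1 -> X i j = 1 -> X i k = X j k.
Proof.
move=> pX Xi Xj Xij; pose u : 'cV[R]_n := 1 *: delta_mx i 0 + (-1) *: delta_mx j 0.
have : X *m u = 0.
  apply: psd_ker => //; rewrite qform_lin ?pX.1 // !qformE !bform_delta Xi Xj Xij.
  by ring.
have XC a b : X a b = X b a by rewrite -{1}pX.1 mxE.
move/(congr1 (fun z : 'cV_n => z k 0)).
rewrite -bform_deltal /u bformDr !bformZr !bform_delta mxE (XC i) (XC j); lra.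
Qed.

Variables (m : nat) (f : 'I_m.+4 -> 'I_n).
Hypothesis cyc : induced_cycle e f.

(* Indexing the cycle by [nat] leaves adjacency questions to [lia]. *)
Let F (i : nat) : 'I_n := f (inord i).

Lemma cycle_inj i j : (i < m.+4)%N -> (j < m.+4)%N -> (F i == F j) = (i == j).
Proof.
move=> im jm; rewrite (inj_eq cyc.1) -val_eqE /= !inordK //.
Qed.

Lemma cycle_adj i j : (i < m.+4)%N -> (j < m.+4)%N ->
  e (F i) (F j) = [|| j == i.+1, i == j.+1, (i == 0%N) && (j == m.+3) |
                      (j == 0%N) && (i == m.+3)].
Proof.
move=> im jm; rewrite cyc.2 -!val_eqE /= !inordK //.
have S t : (t < m.+4)%N -> (t.+1 %% m.+4)%N = if t == m.+3 then 0%N else t.+1.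
  by move=> tm; case: eqP => [->|?]; [rewrite modnn|rewrite modn_small //; lia].
by rewrite !S //; case: (eqVneq i m.+3) => ?; case: (eqVneq j m.+3) => ?; lia.
Qed.

Lemma cycleP v : reflect (exists2 i, (i < m.+4)%N & v = F i) (v \in codom f).
Proof.
apply: (iffP codomP) => [[i ->]|[i im ->]]; last by exists (inord i).
by exists i; rewrite // /F inord_val.
Qed.

Let vb := F m.+2.
Let vc := F m.+3.

(** [cycle_q] and [cycle_r] are the two coordinates of the planar vectors:
    (1, 0) along the cycle except (0, 1) at [vb] and (3/5, 4/5) at [vc]. *)
Definition cycle_q : 'cV[R]_n := \col_v
  if v == vc then 3 / 5 else if v == vb then 0 else (v \in codom f)%:R.
Definition cycle_r : 'cV[R]_n := \col_v
  if v == vc then 4 / 5 else (v == vb)%:R.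
Definition off_cycle : {set 'I_n} := [set v | v \notin codom f].
Definition cycle_X : 'M[R]_n :=
  cycle_q *m cycle_q^T + cycle_r *m cycle_r^T + (proj R off_cycle)^T *m proj R off_cycle.

Lemma cycle_XE i j : cycle_X i j =
  cycle_q i 0 * cycle_q j 0 + cycle_r i 0 * cycle_r j 0 +
  ((i == j) && (i \notin codom f))%:R.
Proof.
rewrite /cycle_X mxE [X in X + _]mxE; congr (_ + _ + _).
- by rewrite mxE big_ord1 [X in _ * X]mxE.
- by rewrite mxE big_ord1 [X in _ * X]mxE.
rewrite proj_tr mul_diag_mx !mxE inE.
by case: (i == j); case: (i \in _); rewrite /= ?mulr1n ?mulr0n ?mulr1 ?mulr0.
Qed.

Lemma psd_cycle_X : psd cycle_X.
Proof. by apply: psdD; [apply: psdD; apply: psd_outer|apply: psd_gram]. Qed.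

Lemma mem_cycle i : (i < m.+4)%N -> F i \in codom f.
Proof. by move=> im; apply/cycleP; exists i. Qed.

Lemma cycle_coordF i : (i <= m.+1)%N ->
  cycle_q (F i) 0 = 1 /\ cycle_r (F i) 0 = 0.
Proof.
move=> im; have [i2 i3] : (i == m.+2) = false /\ (i == m.+3) = false by lia.
by rewrite !mxE /vc /vb !cycle_inj ?mem_cycle ?i2 ?i3 //; lia.
Qed.

Lemma cycle_coordb : cycle_q vb 0 = 0 /\ cycle_r vb 0 = 1.
Proof.
have m23 : (m.+2 == m.+3) = false by lia.
by rewrite !mxE /vc /vb !cycle_inj // m23 eqxx.
Qed.

Lemma cycle_coordc : cycle_q vc 0 = 3 / 5 /\ cycle_r vc 0 = 4 / 5.
Proof. by rewrite !mxE eqxx. Qed.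

Lemma cycle_cases v : v \in codom f ->
  [\/ exists2 i, (i <= m.+1)%N & v = F i, v = vb | v = vc].
Proof.
case/cycleP => i im ->; have [lei|lti] := leqP i m.+1; first by apply: Or31; exists i.
have [->|i2] := eqVneq i m.+2; first exact: Or32.
by apply: Or33; congr F; lia.
Qed.

Lemma cycle_q_off v : v \notin codom f -> cycle_q v 0 = 0.
Proof.
move=> vf; rewrite mxE (negbTE vf); case: eqP => [E|_].
  by rewrite E mem_cycle in vf.
by case: ifP.
Qed.

Lemma cycle_r_off v : v \notin codom f -> cycle_r v 0 = 0.
Proof.
move=> vf; rewrite mxE; case: eqP => [E|_]; first by rewrite E mem_cycle in vf.
by case: eqP => // E; rewrite E mem_cycle in vf.
Qed.

Definition cycle_c (u : edge e) : R := cycle_X (val u).1 (val u).2.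

Lemma cycle_feasible : feasible cycle_c cycle_X.
Proof.
split=> // [|i]; first exact: psd_cycle_X.
rewrite cycle_XE eqxx /=; have [|ni] := boolP (i \in codom f).
  rewrite addr0; case/cycle_cases => [[t tm ->]|->|->].
  - by have [-> ->] := cycle_coordF tm; ring.
  - by have [-> ->] := cycle_coordb; ring.
  - by have [-> ->] := cycle_coordc; field.
by rewrite cycle_q_off // cycle_r_off // !mulr0 !add0r.
Qed.

Lemma cycle_XF i j : (i < m.+4)%N -> (j < m.+4)%N -> cycle_X (F i) (F j) =
  cycle_q (F i) 0 * cycle_q (F j) 0 + cycle_r (F i) 0 * cycle_r (F j) 0.
Proof. by move=> im jm; rewrite cycle_XE mem_cycle // andbF addr0. Qed.

Lemma cycle_completable : completable cycle_c.
Proof.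
split; last by exists cycle_X; apply: cycle_feasible.
by move=> u; have [p X1 _] := cycle_feasible; apply: psd_entry_bound.
Qed.

(** The linear relation between the vectors at [F 0], [vb] and [vc], written as
    nested binary combinations to fit [qform_lin]. *)
Definition cycle_v : 'cV[R]_n :=
  1 *: ((3 / 5) *: delta_mx (F 0) 0 + (4 / 5) *: delta_mx vb 0) + (-1) *: delta_mx vc 0.

(** The edges with entry 1 carry the entry 0 between the last vertex at (1, 0)
    and [vb] over to the pair [F 0], [vb], which is not an edge.  All entries
    of a completion on [F 0], [vb], [vc] are then known, and they are the inner
    products of three vectors with 3/5 (1, 0) + 4/5 (0, 1) = (3/5, 4/5). *)
Lemma cycle_ker X : feasible cycle_c X -> X *m cycle_v = 0.
Proof.
move=> fX; have [pX X1 _] := fX.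
have XF i j : (i < m.+4)%N -> (j < m.+4)%N -> e (F i) (F j) ->
    X (F i) (F j) = cycle_q (F i) 0 * cycle_q (F j) 0 + cycle_r (F i) 0 * cycle_r (F j) 0.
  by move=> im jm eij; rewrite (feasible_edge fX cycle_feasible eij) cycle_XF.
have [qb rb] := cycle_coordb; have [qc rc] := cycle_coordc.
have row_eq i : (i <= m.+1)%N -> X (F i) vb = X (F 0) vb.
  elim: i => // i IH im; rewrite -IH ?(ltnW im) //; apply/esym/psd_entry1_row => //.
  have [q1 r1] := cycle_coordF im; have [q2 r2] := cycle_coordF (ltnW im).
  rewrite XF ?cycle_adj ?eqxx //; try lia.
  by rewrite q1 q2 r1 r2; ring.
have [q0 r0] := cycle_coordF (leq0n m.+1).
have X0b : X (F 0) vb = 0.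
  have [q1 r1] := cycle_coordF (leqnn m.+1 : (m.+1 <= m.+1)%N).
  by rewrite -(row_eq m.+1) // XF ?cycle_adj ?eqxx // -/vb ?q1 ?r1 ?qb; try lia; ring.
have X0c : X (F 0) vc = 3 / 5.
  by rewrite XF ?cycle_adj ?eqxx ?orbT // -/vc q0 r0 qc; ring.
have Xbc : X vb vc = 4 / 5.
  by rewrite XF ?cycle_adj ?eqxx // -/vc -/vb qb rb rc; ring.
apply: psd_ker => //; rewrite !qform_lin ?pX.1 // bformDl !bformZl !qformE !bform_delta.
by rewrite !X1 X0b X0c Xbc; field.
Qed.

Lemma cycle_v_c : cycle_v vc 0 = -1.
Proof.
have m32 : (m.+3 == m.+2) = false by lia.
by rewrite !mxE /vb /vc !cycle_inj // !eqxx m32 /=; ring.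
Qed.

(** A stress annihilating [cycle_X] annihilates both coordinate vectors.  In row
    [F 0], only [vb] and [vc] have a nonzero second coordinate, and [vb] is not
    adjacent to [F 0], so the entry at [vc] vanishes.  In row [vc], the first
    coordinate vanishes at the neighbour [vb], and the other neighbour [F 0]
    was just excluded, so the diagonal entry vanishes. *)
Lemma cycle_stress (w : stress R e) : psd (stress_mx w) -> stress_mx w *m cycle_X = 0 ->
  qform (stress_mx w) (delta_mx vc 0) = 0.
Proof.
set W := stress_mx w => pW WX.
have Wnon i j : i != j -> ~~ e i j -> W i j = 0 by exact: stress_mx_nonedge.
have [qW rW] : (forall i, (W *m cycle_q) i 0 = 0) /\ (forall i, (W *m cycle_r) i 0 = 0).
  suff H i : (cycle_q^T *m (W *m delta_mx i 0 : 'cV_n)) 0 0 = 0 /\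
             (cycle_r^T *m (W *m delta_mx i 0 : 'cV_n)) 0 0 = 0.
    split=> i; rewrite -bform_deltal bformC ?pW.1 // /bform -mulmxA;
      by case: (H i).
  have XW : cycle_X *m (W *m delta_mx i 0) = 0 :> 'cV_n.
    rewrite mulmxA; apply: trmx_inj; rewrite trmx_mul trmx0.
    by rewrite trmx_mul pW.1 psd_cycle_X.1 WX mulmx0.
  have := qform_ker XW; rewrite qformE !bformDm !bform_outer => q0.
  have := (psd_gram (proj R off_cycle)).2 (W *m delta_mx i 0); rewrite qformE => q1.
  by split; nra.
rewrite qformE bform_delta.
have W0c : W (F 0) vc = 0.
  have := rW (F 0); rewrite mxE (bigD1 vc) //= (bigD1 vb) /=; last first.
    by rewrite /vb /vc cycle_inj //; lia.
  rewrite (Wnon _ vb) ?cycle_inj ?cycle_adj //; try lia.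
  rewrite big1 ?addr0 => [|j /andP[jc jb]]; last first.
    by rewrite [X in _ * X]mxE (negbTE jc) (negbTE jb) mulr0.
  by rewrite mul0r addr0 cycle_coordc.2 => H; lra.
have := qW vc; rewrite mxE (bigD1 vc) //= big1 => [|j jc].
  by rewrite addr0 cycle_coordc.1 => H; lra.
have [|nj] := boolP (j \in codom f); last by rewrite cycle_q_off ?mulr0.
case/cycle_cases => [[t tm jt]|->|/eqP]; last by rewrite (negbTE jc).
  have [t0|t0] := eqVneq t 0%N.
    have WC : W vc (F 0) = W (F 0) vc by rewrite -{1}pW.1 mxE.
    by rewrite jt t0 WC W0c mul0r.
  rewrite jt Wnon ?mul0r // ?cycle_inj ?cycle_adj //; lia.
by rewrite cycle_coordb.1 mulr0.
Qed.

(** The kernel of a certificate of length at most one would be the image of a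
    completion [X] of maximum rank.  It contains the basis vector at [vc], but
    [cycle_v], which is in the kernel of [X], is not orthogonal to it. *)
Lemma cycle_no_certificate k (w : 'I_k -> stress R e) :
  (k <= 1)%N -> ~ certificate cycle_c w.
Proof.
move=> k1 [wpos wtr [s [[X fX rX] _] [U UV dU]]].
have pw i : psd (stress_mx (w i)).
  split; first exact: stress_mx_sym.
  by move=> x; apply: wpos => j; have := ltn_ord i; lia.
have wX Y i : feasible cycle_c Y -> stress_mx (w i) *m Y = 0.
  move=> fY; have [pY _ _] := fY; apply: psd_trace0 => //.
  by rewrite (feasible_tr _ fY).
have [V VX dV] := is_dim_image X.
have VU : (V <= U)%VS.
  apply/subvP => x /VX[y ->]; apply/UV => i _.
  by rewrite qform_ker // mulmxA wX // mul0mx.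
have eVU : V = U by apply/eqP; rewrite eqEdim VU dU dV rX leqnn.
have /VX[y yE] : delta_mx vc 0 \in V.
  rewrite eVU; apply/UV => i _; apply: cycle_stress => //; apply: wX.
  exact: cycle_feasible.
have [[Xs _] _ _] := fX.
have : (cycle_v^T *m (delta_mx vc 0 : 'cV_n)) 0 0 = 0.
  rewrite yE -{1}Xs mulmxA -trmx_mul cycle_ker // trmx0 mul0mx mxE //.
by rewrite -colE [LHS]mxE [LHS]mxE cycle_v_c => /eqP; rewrite oppr_eq0 oner_eq0.
Qed.

End Cycle.

(** * Singularity degree and chordality *)

Theorem theorem4p5 (R : realType) (n : nat) (e : rel 'I_n)
    (n_gt0 : (0 < n)%N) (e_sym : symmetric e) (e_irr : irreflexive e) :
  (exists2 d : nat, sd_graph R e d & (d <= 1)%N) <-> chordal e.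
Proof.
split=> [[d [_ sd_le] d1] [k [f k4 cyc]]|ch].
  case: k => [|[|[|[|m]]]] // in f k4 cyc *.
  have [k sdk kd] := sd_le _ (cycle_completable R cyc).
  case: sdk => [[[X fX pX] _]|[_ [w wc] _]].
    have v0 : cycle_v R f != 0.
      apply: contra_eq_neq (cycle_v_c R cyc) => ->; rewrite mxE eq_sym oppr_eq0.
      exact: oner_neq0.
    by have := pX.2 _ v0; rewrite qform_ker ?ltxx // (cycle_ker e_sym e_irr cyc fX).
  by apply: (cycle_no_certificate e_sym e_irr cyc _ wc); apply: leq_trans kd d1.
pose posdef_completable (c : edge e -> R) := exists2 X, feasible c X & posdef X.
have sd0 c : posdef_completable c -> sd_completion c 0 by left.
have sd1 c : completable c -> ~ posdef_completable c -> sd_completion c 1.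
  move=> [_ [X fX]] npd; right; split=> //; first exact: chordal_certificate fX.
  (* A certificate of length 0 means maximum rank [n], so [Y] below is definite. *)
  case=> // -[w [_ _ [s [[Y fY rY] _] [U UV dU]]]]; case: npd.
  exists Y => //; have [pY _ _] := fY; apply: psd_full_rank => //.
  rewrite rY -dU (_ : U = fullv) ?dimvf /dim /= ?muln1 //.
  by apply/vspaceP => x; rewrite memvf; apply/UV => -[].
pose c0 (_ : edge e) : R := 0.
have fc0 : feasible c0 1%:M.
  split; first by have := psd_gram (1%:M : 'M[R]_n); rewrite mulmx1 trmx1.
    by move=> i; rewrite mxE eqxx.
  case=> -[a b] uP; rewrite mxE; have /andP[/= ab _] := uP.
  by case: eqP => // E; rewrite E ltnn in ab.
have pd0 : posdef_completable c0.
  exists 1%:M => //; apply: psd_full_rank; first by case: fc0.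
  by rewrite mxrank1.
have cc0 : completable c0.
  by split=> [u|]; [rewrite /c0 lerN10 ler01|exists 1%:M].
have [[c [cc npc]]|allpd] := pselect (exists c, completable c /\ ~ posdef_completable c).
  exists 1%N => //; split; first by exists c; last exact: sd1.
  move=> c' cc'; have [/sd0|/(sd1 _ cc')] := pselect (posdef_completable c').
    by exists 0%N.
  by exists 1%N.
exists 0%N => //; split; first by exists c0; last exact: sd0.
move=> c cc; exists 0%N => //; apply: sd0; apply: contrapT => npc.
by apply: allpd; exists c.
Qed.
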